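(* Let $m$ be a positive integer and $\lambda$ a nonzero real number. Then, as formal power series in $t$, $$e_{\lambda}(t)\,e^{x\left(\frac{e_{\lambda}^{m}(t)-1}{m}\right)}=\sum_{n=0}^{\infty}D_{m,\lambda}(n,x)\frac{t^{n}}{n!}.$$
   Context: For a nonzero real $\lambda$: $(x)_{0,\lambda}=1$, $(x)_{n,\lambda}=x(x-\lambda)\cdots(x-(n-1)\lambda)$ for $n\ge1$; $(x)_n=(x)_{n,1}$. The degenerate exponential is $e_\lambda^x(t)=(1+\lambda t)^{x/\lambda}=\sum_{n\ge0}(x)_{n,\lambda}t^n/n!$, $e_\lambda(t)=e_\lambda^1(t)$. The degenerate Whitney numbers of the second kind $W_{m,\lambda}(n,k)$ are defined by $(mx+1)_{n,\lambda}=\sum_{k=0}^{n}W_{m,\lambda}(n,k)m^{k}(x)_{k}$ ($n\ge0$), and the degenerate Dowling polynomials are $D_{m,\lambda}(n,x)=\sum_{k=0}^{n}W_{m,\lambda}(n,k)x^{k}$. *)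

(* Defs.v *)
From HB Require Import structures.
From mathcomp Require Import all_boot all_order all_algebra.
From mathcomp Require Import boolp reals ring.
Set Implicit Arguments.
Unset Strict Implicit.
Unset Printing Implicit Defensive.
Import GRing.Theory Num.Theory.
Local Open Scope ring_scope.

(* Formal power series in t: [f n] is the coefficient of t^n.  The product of
   the ring structure below is the Cauchy product. *)
Record fps (A : Type) := Fps { coeff :> nat -> A }.

HB.instance Definition _ (A : Type) := gen_eqMixin (fps A).
HB.instance Definition _ (A : Type) := gen_choiceMixin (fps A).

Lemma fpsP (A : Type) (f g : fps A) : f =1 g <-> f = g.
Proof.
split=> [|-> //]; case: f => f; case: g => g /= fg.
by congr Fps; apply/funext.
Qed.

Section Ring.
Variable A : comNzRingType.
Implicit Types (f g h : fps A) (a b : A).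

Definition fps_zero : fps A := Fps (fun _ => 0).
Definition fps_opp f : fps A := Fps (fun n => - f n).
Definition fps_add f g : fps A := Fps (fun n => f n + g n).
Definition fps_one : fps A := Fps (fun n => (n == 0)%:R).
Definition fps_mul f g : fps A := Fps (fun n => \sum_(i < n.+1) f i * g (n - i)%N).
Definition fps_scale a f : fps A := Fps (fun n => a * f n).

Fact fps_addA : associative fps_add.
Proof. by move=> f g h; apply/fpsP => n /=; rewrite addrA. Qed.
Fact fps_addC : commutative fps_add.
Proof. by move=> f g; apply/fpsP => n /=; rewrite addrC. Qed.
Fact fps_add0 : left_id fps_zero fps_add.
Proof. by move=> f; apply/fpsP => n /=; rewrite add0r. Qed.
Fact fps_addN : left_inverse fps_zero fps_opp fps_add.
Proof. by move=> f; apply/fpsP => n /=; rewrite addNr. Qed.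

HB.instance Definition _ := GRing.isZmodule.Build (fps A)
  fps_addA fps_addC fps_add0 fps_addN.

Fact fps_mul_poly N f g n : (n < N)%N ->
  fps_mul f g n = ((\poly_(i < N) f i) * (\poly_(i < N) g i))`_n.
Proof.
move=> nN /=; rewrite coefM; apply: eq_bigr => i _.
have iN : (i < N)%N by apply: leq_trans (ltn_ord i) nN.
by rewrite !coef_poly iN (leq_ltn_trans (leq_subr i n) nN).
Qed.

Fact fps_mulC : commutative fps_mul.
Proof.
by move=> f g; apply/fpsP => n; rewrite !(@fps_mul_poly n.+1) // mulrC.
Qed.

Fact fps_mulA : associative fps_mul.
Proof.
have aux f g h n : fps_mul (fps_mul f g) h n =
    ((\poly_(i < n.+1) f i) * (\poly_(i < n.+1) g i)
       * (\poly_(i < n.+1) h i))`_n.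
  rewrite [RHS]coefM /=; apply: eq_bigr => i _.
  rewrite -[\sum_(_ < _) _]/(fps_mul f g i) (@fps_mul_poly n.+1) ?ltn_ord //.
  by rewrite [X in _ = _ * X]coef_poly ltnS leq_subr.
move=> f g h; apply/fpsP => n; rewrite [in RHS]aux fps_mulC aux.
by rewrite mulrC mulrA.
Qed.

Fact fps_mul1 : left_id fps_one fps_mul.
Proof.
move=> f; apply/fpsP => n /=; rewrite big_ord_recl /= mul1r subn0 big1 ?addr0 //.
by move=> i _; rewrite mul0r.
Qed.

Fact fps_mulD : left_distributive fps_mul +%R.
Proof.
move=> f g h; apply/fpsP => n /=; rewrite -big_split.
by apply: eq_bigr => i _ /=; rewrite mulrDl.
Qed.

Fact fps_one_neq0 : fps_one != 0.
Proof.
apply/eqP => /fpsP/(_ 0%N) /= /eqP; exact/negP/oner_neq0.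
Qed.

HB.instance Definition _ := GRing.Zmodule_isComNzRing.Build (fps A)
  fps_mulA fps_mulC fps_mul1 fps_mulD fps_one_neq0.

Fact fps_scaleA a b f : fps_scale a (fps_scale b f) = fps_scale (a * b) f.
Proof. by apply/fpsP => n /=; rewrite mulrA. Qed.
Fact fps_scale1 : left_id 1 fps_scale.
Proof. by move=> f; apply/fpsP => n /=; rewrite mul1r. Qed.
Fact fps_scaleDr : right_distributive fps_scale +%R.
Proof. by move=> a f g; apply/fpsP => n /=; rewrite mulrDr. Qed.
Fact fps_scaleDl f : {morph fps_scale^~ f : a b / a + b}.
Proof. by move=> a b; apply/fpsP => n /=; rewrite mulrDl. Qed.

HB.instance Definition _ := GRing.Zmodule_isLmodule.Build A (fps A)
  fps_scaleA fps_scale1 fps_scaleDr fps_scaleDl.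

Fact coeff_expr_eq0 g k n : g 0%N = 0 -> (n < k)%N -> (g ^+ k) n = 0.
Proof.
move=> g0; elim: k n => // k IHk n; rewrite ltnS => le_nk.
rewrite exprS -[LHS]/(\sum_(i < n.+1) g i * (g ^+ k) (n - i)%N).
rewrite big_ord_recl g0 mul0r add0r big1 // => i _.
rewrite IHk ?mulr0 // (leq_trans _ le_nk) // lift0 ltn_subrL /=.
by case: n i {le_nk} => [[]|].
Qed.

End Ring.

Section Series.
Variables (F : numFieldType) (A : comAlgType F).

(* \sum_n a_n t^n / n! *)
Definition egf (a : nat -> A) : fps A := Fps (fun n => (n`!%:R : F)^-1 *: a n).

(* e^g = \sum_k g^k / k! for a series g with zero constant term: then g^k has
   no term of degree n < k, so the coefficient of t^n is a finite sum, see
   [fps_exp_trunc].  For g 0 <> 0 the value is meaningless. *)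
Definition fps_exp (g : fps A) : fps A :=
  Fps (fun n => \sum_(k < n.+1) (k`!%:R : F)^-1 *: (g ^+ k) n).

Lemma fps_exp_trunc (g : fps A) n N : g 0%N = 0 -> (n <= N)%N ->
  fps_exp g n = \sum_(k < N.+1) (k`!%:R : F)^-1 *: (g ^+ k) n.
Proof.
move=> g0 nN /=; pose u k := (k`!%:R : F)^-1 *: (g ^+ k) n.
rewrite -!(big_mkord xpredT u) [RHS](@big_cat_nat _ _ _ n.+1) //=.
rewrite [X in _ + X]big_nat [X in _ + X]big1 ?addr0 // => k /andP[nk _].
by rewrite /u coeff_expr_eq0 ?scaler0.
Qed.

(* (x)_{n,lam} *)
Definition dfact (lam : F) (n : nat) (x : A) : A :=
  \prod_(i < n) (x - (i%:R * lam)%:A).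

(* e_lam^x(t) = (1 + lam t)^(x/lam) *)
Definition dexp (lam : F) (x : A) : fps A := egf (fun n => dfact lam n x).

Lemma dexp_coeff0 lam x : dexp lam x 0%N = 1.
Proof. by rewrite /= /dfact big_ord0 fact0 invr1 scale1r. Qed.

End Series.

Section Whitney.
Variable F : numFieldType.

(* W is the array of degenerate Whitney numbers of the second kind: the
   defining relation determines W n k for k <= n when m > 0. *)
Definition is_dwhitney2 (m : nat) (lam : F) (W : nat -> nat -> F) : Prop :=
  forall n : nat, dfact lam n (m%:R * 'X + 1 : {poly F}) =
    \sum_(k < n.+1) (W n k * m%:R ^+ k) *: dfact 1 k ('X : {poly F}).

Definition dowling (W : nat -> nat -> F) (n : nat) : {poly F} :=
  \sum_(k < n.+1) W n k *: 'X^k.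

Lemma dwhitney2_exists (m : nat) (lam : F) : exists W, is_dwhitney2 m lam W.
Proof.
pose fix W (n k : nat) {struct n} : F :=
  if n is n'.+1 then
    (if k is k'.+1 then W n' k' else 0) + (m%:R * k%:R + 1 - n'%:R * lam) * W n' k
  else (k == 0)%:R.
have W0 n k : (n < k)%N -> W n k = 0.
  elim: n k => [|n IHn] [|k] //= nk; rewrite !IHn ?mulr0 ?addr0 //.
  exact: ltnW.
exists W; elim=> [|n IHn].
  by rewrite big_ord_recl big_ord0 /dfact !big_ord0 /= mul1r scale1r addr0.
rewrite /dfact big_ord_recr /= -/(dfact _ _ _) IHn mulr_suml.
pose P k : {poly F} := dfact 1 k 'X.
have step k : P k * (m%:R * 'X + 1 - (n%:R * lam)%:A) =
    m%:R *: P k.+1 + (m%:R * k%:R + 1 - n%:R * lam) *: P k.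
  rewrite /P {2}/dfact big_ord_recr /= -/(dfact 1 k 'X) mulr1.
  rewrite -!mul_polyC !mulr1 !(polyCD, polyCN, polyCM, polyC1, polyC_natr).
  by ring.
rewrite (eq_bigr (fun k : 'I_n.+1 => (W n k * m%:R ^+ k.+1) *: P k.+1 +
    ((m%:R * k%:R + 1 - n%:R * lam) * W n k * m%:R ^+ k) *: P k)); last first.
  move=> k _; rewrite -scalerAl step scalerDr !scalerA exprSr mulrA.
  by congr (_ + _ *: _); rewrite mulrC mulrA.
rewrite big_split /= [RHS](eq_bigr (fun k : 'I_n.+2 =>
    ((if k : nat is k'.+1 then W n k' else 0) * m%:R ^+ k) *: P k +
    ((m%:R * k%:R + 1 - n%:R * lam) * W n k * m%:R ^+ k) *: P k)); last first.
  by move=> k _; rewrite -scalerDl -mulrDl; case: k => [[|k] ?].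
rewrite big_split /= [X in _ = X + _]big_ord_recl /= mul0r scale0r add0r.
congr (_ + _).
by rewrite [RHS]big_ord_recr /= W0 // mulr0 mul0r scale0r addr0.
Qed.

End Whitney.

(* Main.v *)
(** Write [E_x] for [e_lam^x(t)].  Since [E_(x+y) = E_x * E_y], the binomial
    theorem for [E_m = 1 + (E_m - 1)] gives, for every natural number [j],
    [E_(m j + 1) = \sum_k (j)_k / k! * E_1 * (E_m - 1)^k].  The coefficient of
    [t^n / n!] on the left is [(m j + 1)_(n,lam) = \sum_k W(n,k) m^k (j)_k];
    both expansions in [(j)_k] are triangular in [j], so they agree term by
    term: [W(n,k) m^k / n!] is the coefficient of [t^n] in
    [E_1 * (E_m - 1)^k / k!].  Multiplying by [x^k / m^k] and summing over [k]
    gives the theorem. *)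
Require Import Defs.
From HB Require Import structures.
From mathcomp Require Import all_boot all_order all_algebra.
From mathcomp Require Import boolp reals.
Import GRing.Theory Num.Theory.
Local Open Scope ring_scope.

Section Coefficients.
Set Implicit Arguments.
Unset Strict Implicit.
Variable A : comNzRingType.
Implicit Types (f g : fps A) (a : A).

Lemma coeff_fpsM f g n : (f * g) n = \sum_(i < n.+1) f i * g (n - i)%N.
Proof. by []. Qed.

Lemma coeff_fpsZ a f n : (a *: f) n = a * f n.
Proof. by []. Qed.

Lemma coeff_fpsMn f k n : (f *+ k) n = f n *+ k.
Proof. by elim: k => [//|k IHk]; rewrite !mulrS -IHk. Qed.

Lemma coeff_fps_sum (I : Type) (r : seq I) (P : pred I) (f : I -> fps A) n :
  (\sum_(i <- r | P i) f i) n = \sum_(i <- r | P i) f i n.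
Proof. exact: (big_morph (fun g : fps A => g n) (fun _ _ => erefl) erefl). Qed.

Lemma fps_scaleAl a f g : a *: (f * g) = (a *: f) * g.
Proof.
apply/fpsP => n; rewrite coeff_fpsM [LHS]mulr_sumr.
by apply: eq_bigr => i _; rewrite mulrA.
Qed.

Lemma fps_exprZn a f k : (a *: f) ^+ k = a ^+ k *: f ^+ k.
Proof.
elim: k => [|k IHk]; first by rewrite !expr0 scale1r.
rewrite !exprS IHk -fps_scaleAl [f * (_ *: _)]mulrC -fps_scaleAl scalerA.
by rewrite [_ * f]mulrC.
Qed.

End Coefficients.

Section DegenerateExponential.
Set Implicit Arguments.
Unset Strict Implicit.
Variables (F : numFieldType) (A : comAlgType F) (lam : F).
Implicit Types (x y : A) (f g : fps A).

Lemma factr_neq0 n : (n`!%:R : F) != 0.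
Proof. by rewrite pnatr_eq0 -lt0n fact_gt0. Qed.

Lemma dfactS n x :
  dfact lam n.+1 x = dfact lam n x * (x - (n%:R * lam)%:A).
Proof. exact: big_ord_recr. Qed.

(** This compares the coefficients of [t^n] in [(1 + lam t) f' = x f] for [f = dexp lam x]; the term
    [lam t f'] gives [n lam f n], moved to the right. *)
Lemma dexp_coeffS x n :
  dexp lam x n.+1 *+ n.+1 = (x - (n%:R * lam)%:A) * dexp lam x n.
Proof.
rewrite /= dfactS -scaler_nat scalerA -scalerAr [in RHS]mulrC factS natrM.
by rewrite invfM mulrA divff ?mul1r // pnatr_eq0.
Qed.

Lemma dexp_unique x f : f 0%N = 1 ->
    (forall n, f n.+1 *+ n.+1 = (x - (n%:R * lam)%:A) * f n) ->
  f = dexp lam x.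
Proof.
move=> f0 fS; apply/fpsP; elim=> [|n IHn]; first by rewrite dexp_coeff0.
have n0 : (n.+1%:R : F) != 0 by rewrite pnatr_eq0.
by apply: (scalerI n0); rewrite !scaler_nat fS dexp_coeffS IHn.
Qed.

(* Leibniz rule: [E_x] is the solution of [(1 + lam t) f' = x f], [f 0 = 1]. *)
Lemma dexpD x y : dexp lam (x + y) = dexp lam x * dexp lam y.
Proof.
apply/esym/dexp_unique => [|n].
  by rewrite coeff_fpsM big_ord1 !dexp_coeff0 mul1r.
have := dexp_coeffS y; have := dexp_coeffS x.
move: (dexp lam x) (dexp lam y) => f g fS gS; rewrite !coeff_fpsM.
(* Splitting the weight as [n.+1 = i + (n.+1 - i)] yields the coefficients of [f' g] and [f g']. *)
have -> : (\sum_(i < n.+2) f i * g (n.+1 - i)%N) *+ n.+1 =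
    \sum_(i < n.+2) (f i *+ i) * g (n.+1 - i)%N +
    \sum_(i < n.+2) f i * (g (n.+1 - i)%N *+ (n.+1 - i)).
  rewrite -sumrMnl -big_split; apply: eq_bigr => i _ /=.
  by rewrite mulrnAl mulrnAr -mulrnDr subnKC // -ltnS.
rewrite big_ord_recl mulr0n mul0r add0r.
rewrite [X in _ + X]big_ord_recr /= subnn mulr0n mulr0 addr0 -big_split.
rewrite mulr_sumr; apply: eq_bigr => i _ /=.
have le_in : (i <= n)%N by rewrite -ltnS.
rewrite /bump add1n subSS subSn // fS gS -mulrA [X in _ + X]mulrCA -mulrDl.
by rewrite addrACA -opprD -scalerDl -mulrDl -natrD subnKC.
Qed.

Lemma dexp_natM j x y : dexp lam (x * j%:R + y) = dexp lam y * dexp lam x ^+ j.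
Proof.
elim: j => [|j IHj]; first by rewrite mulr0 add0r expr0 mulr1.
by rewrite -natr1 mulrDr mulr1 addrAC dexpD IHj exprSr mulrA.
Qed.

(** The sum runs to [n] rather than [j]: the added binomials vanish, and all [j <= n] share one
    index range, as [ffact_expansion_inj] requires. *)
Lemma dexp_natM_newton n j x y : (j <= n)%N ->
  dexp lam (x * j%:R + y) =
    \sum_(k < n.+1) (dexp lam y * (dexp lam x - 1) ^+ k) *+ 'C(j, k).
Proof.
move=> le_jn; rewrite dexp_natM -{1}[dexp lam x](subrK 1) exprD1n mulr_sumr.
pose u k := (dexp lam y * (dexp lam x - 1) ^+ k) *+ 'C(j, k).
rewrite (eq_bigr (fun k : 'I_j.+1 => u k)) => [|k _]; last by rewrite mulrnAr.
rewrite (big_ord_widen n.+1 u) // big_mkcond; apply: eq_bigr => k _.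
by case: ltnP => // lt_jk; rewrite bin_small.
Qed.

Lemma dfact1_nat k j : dfact (1 : F) k (j%:R : A) = (j ^_ k)%:R.
Proof.
elim: k => [|k IHk]; first by rewrite /dfact big_ord0.
rewrite /dfact big_ord_recr /= -/(dfact _ _ _) IHk mulr1 scaler_nat.
(* For [j < k] the truncated [j - k] is not the difference in [A], but then [j ^_ k = 0] kills both
   sides. *)
rewrite ffactnSr natrM; have [le_kj | lt_jk] := leqP k j; first by rewrite natrB.
by rewrite ffact_small // !mul0r.
Qed.

Lemma rmorph_dfact (B : comAlgType F) (h : {rmorphism A -> B}) n x :
  (forall a : F, h a%:A = a%:A) -> h (dfact lam n x) = dfact lam n (h x).
Proof.
by move=> hA; rewrite rmorph_prod; apply: eq_bigr => i _; rewrite rmorphB /= hA.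
Qed.

(* The matrix of the [(j)_k], [j, k <= n], is triangular with diagonal
   entries [k! <> 0]. *)
Lemma ffact_expansion_inj n (a b : nat -> A) :
    (forall j, (j <= n)%N ->
       \sum_(k < n.+1) a k *+ j ^_ k = \sum_(k < n.+1) b k *+ j ^_ k) ->
  forall k, (k <= n)%N -> a k = b k.
Proof.
move=> eq_ab; elim/ltn_ind=> k IHk le_kn.
have := eq_ab k le_kn.
rewrite (bigD1 (Ordinal (le_kn : (k < n.+1)%N))) //=.
rewrite [RHS](bigD1 (Ordinal (le_kn : (k < n.+1)%N))) //=.
(* At [j = k] the terms below [k] agree by induction and those above vanish, leaving [k!] times the
   unknown. *)
rewrite (eq_bigr (fun i : 'I_n.+1 => b i *+ k ^_ i)) => [/addIr|i].
  rewrite ffactnn -!(scaler_nat k`!); exact: (scalerI (factr_neq0 k)).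
rewrite -val_eqE /= => ne_ik.
have [lt_ik | le_ki] := ltnP i k; first by rewrite IHk // -ltnS.
by rewrite ffact_small // ltn_neqAle eq_sym ne_ik.
Qed.

End DegenerateExponential.

Section Whitney.
Set Implicit Arguments.
Unset Strict Implicit.
Variables (F : numFieldType) (A : comAlgType F).
Variables (m : nat) (lam : F) (W : nat -> nat -> F).
Hypothesis hW : is_dwhitney2 m lam W.

(** Evaluating ['X] at [x] carries the defining identity from [{poly F}] to any commutative
    [F]-algebra. *)
Lemma dfact_whitney n (x : A) : dfact lam n (m%:R * x + 1) =
  \sum_(k < n.+1) (W n k * m%:R ^+ k) *: dfact 1 k x.
Proof.
have hA a : horner_alg x a%:A = a%:A by rewrite alg_polyC horner_algC.
have := congr1 (horner_alg x) (hW n).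
rewrite rmorph_dfact // rmorphD rmorphM rmorph_nat /= rmorph1 horner_algX => ->.
rewrite rmorph_sum; apply: eq_bigr => k _.
by rewrite -mul_polyC rmorphM rmorph_dfact //= horner_algC horner_algX mulr_algl.
Qed.

Lemma whitney_coeff n k : (k <= n)%N ->
  (k`!%:R : F)^-1 *:
    (dexp lam (1 : A) * (dexp lam (m%:R : A) - 1) ^+ k) n =
  ((n`!%:R : F)^-1 * (W n k * m%:R ^+ k))%:A.
Proof.
(* As coefficients of [(j)_k], both sides expand the coefficient of [t^n] in [E_(m j + 1)]. *)
move: k; apply: (ffact_expansion_inj (n := n)) => j le_jn.
have := congr1 (fun f : fps A => f n) (dexp_natM_newton lam m%:R 1 le_jn).
rewrite coeff_fps_sum /= dfact_whitney scaler_sumr => eq_j.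
transitivity (\sum_(k < n.+1) (dexp lam (1 : A) *
    (dexp lam (m%:R : A) - 1) ^+ k) n *+ 'C(j, k)).
  apply: eq_bigr => k _; rewrite -bin_ffact mulnC mulrnA -[_ *+ k`!]scaler_nat.
  by rewrite scalerA divff ?factr_neq0 // scale1r.
rewrite (eq_bigr _ (fun (k : 'I_n.+1) _ => esym (coeff_fpsMn _ _ n))) -eq_j.
apply: eq_bigr => k _.
by rewrite dfact1_nat scalerA scalerMnr.
Qed.

End Whitney.

Theorem theorem3 (R : realType) (m : nat) (lam : R) (W : nat -> nat -> R)
    (hm : (0 < m)%N) (hlam : lam != 0) (hW : is_dwhitney2 m lam W) :
  dexp lam (1 : {poly R})
    * fps_exp ('X *: ((m%:R^-1)%:P *: (dexp lam (m%:R : {poly R}) - 1)))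
  = egf (dowling W).
Proof.
have m0 : m%:R != 0 :> R by rewrite pnatr_eq0 -lt0n.
set u := dexp lam m%:R - 1; rewrite scalerA; set c := 'X * _.
have u0 : (c *: u) 0%N = 0.
  rewrite coeff_fpsZ -[u 0%N]/(dexp lam m%:R 0%N - 1).
  by rewrite dexp_coeff0 subrr mulr0.
apply/fpsP => n; rewrite coeff_fpsM.
transitivity (\sum_(k < n.+1) (k`!%:R : R)^-1 *:
    (dexp lam 1 * (c *: u) ^+ k) n).
  (* Since [c *: u] has zero constant term, the exponential sums, of length depending on [i], all
     extend to the bound [n]; the two sums can then be exchanged. *)
  rewrite (eq_bigr _ (fun (i : 'I_n.+1) _ =>
    congr1 _ (fps_exp_trunc u0 (leq_subr i n)))).
  under eq_bigr => i _ do rewrite mulr_sumr.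
  rewrite exchange_big; apply: eq_bigr => k _.
  rewrite coeff_fpsM scaler_sumr; apply: eq_bigr => i _.
  by rewrite scalerAr.
rewrite -[RHS]/(_ *: dowling W n) scaler_sumr; apply: eq_bigr => k _.
(* The scalar [c ^+ k] is [x^k / m^k]; its denominator cancels the [m^k] of [whitney_coeff]. *)
rewrite fps_exprZn [dexp _ _ * _]mulrC -fps_scaleAl coeff_fpsZ.
have le_kn : (k <= n)%N by rewrite -ltnS.
have := whitney_coeff {poly R} hW le_kn; rewrite -/u => wE.
rewrite scalerAr [u ^+ k * _]mulrC wE.
rewrite -scalerAr mulr1 exprMn -polyC_exp exprVn.
rewrite [_ * _%:P]mulrC mul_polyC !scalerA; congr (_ *: _).
by rewrite mulrA mulfK ?expf_neq0.
Qed.
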